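(* Let $\Sigma$ be a signed graph. Then $\Sigma$ is balanced if and only if $\mathsf E(\Sigma,x)=\mathsf O(\Sigma,x)$.
   Context: A signed graph $\Sigma=(\Gamma,\sigma)$ is a finite simple graph $\Gamma$ with a signature $\sigma:E(\Gamma)\to\{\pm1\}$. $\Sigma$ is balanced if every cycle of $\Gamma$ contains an even number of negative edges. For an integer $\lambda\ge 0$, let $C_\lambda$ be the set of nonzero integers in $[-\lambda/2,\lambda/2]$ if $\lambda$ is even, and the set of integers in $[-(\lambda-1)/2,(\lambda-1)/2]$ if $\lambda$ is odd. A proper $C_\lambda$-colouring of $\Sigma$ is a map $\kappa:V(\Gamma)\to C_\lambda$ with $\kappa(v)\ne\sigma(\{v,w\})\kappa(w)$ for every edge $\{v,w\}$; $f(\Sigma,\lambda)$ denotes their number. $\mathsf E(\Sigma,x),\mathsf O(\Sigma,x)\in\mathbb Z[x]$ are the unique polynomials with $f(\Sigma,\lambda)=\mathsf E(\Sigma,\lambda)$ for all even $\lambda\ge0$ and $f(\Sigma,\lambda)=\mathsf O(\Sigma,\lambda)$ for all odd $\lambda\ge0$. *)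

(* Defs.v *)
From HB Require Import structures.
From mathcomp Require Import all_boot all_order all_algebra.
From mathcomp Require Import zify.

Set Implicit Arguments.
Unset Strict Implicit.
Unset Printing Implicit Defensive.

Import Order.TTheory GRing.Theory Num.Theory.
Local Open Scope ring_scope.

(* Edges are two-element sets of vertices; the values of [sgn] outside [edges]
   are never used. *)
Record signed_graph := SignedGraph {
  vertex :> finType;
  edges : {set {set vertex}};
  sgn : {set vertex} -> int;
  edges_card2 : forall a, a \in edges -> #|a| = 2;
  sgn_pm1 : forall a, a \in edges -> sgn a = 1 \/ sgn a = -1
}.

Definition adj (S : signed_graph) : rel S := fun v w => [set v; w] \in edges S.

Definition graph_cycle (S : signed_graph) (c : seq S) : Prop :=
  ucycle (@adj S) c /\ (2 < size c)%N.

(* The edges of the cycle [c] are the [set v; next c v] for v in c; they are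
   pairwise distinct since [2 < size c]. *)
Definition num_neg (S : signed_graph) (c : seq S) : nat :=
  count (fun v => sgn [set v; next c v] == -1) c.

Definition balanced (S : signed_graph) : Prop :=
  forall c : seq S, graph_cycle c -> ~~ odd (num_neg c).

Definition int_range (k : nat) : seq int :=
  [seq i%:Z - k%:Z | i <- iota 0 k.*2.+1].

(* For odd l, (l - 1) / 2 = l./2. *)
Definition colours (l : nat) : seq int :=
  if odd l then int_range l./2 else [seq c <- int_range l./2 | c != 0].

Definition proper_colouring (S : signed_graph) (l : nat)
    (k : {ffun S -> seq_sub (colours l)}) : bool :=
  [forall v, forall w,
     adj v w ==> (ssval (k v) != sgn [set v; w] * ssval (k w))].

Definition num_colourings (S : signed_graph) (l : nat) : nat :=
  #|[set k : {ffun S -> seq_sub (colours l)} | proper_colouring k]|.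

Lemma mem_int_range k (c : int) : (c \in int_range k) = (- k%:Z <= c <= k%:Z).
Proof.
apply/mapP/idP => [[i]|H]; first by rewrite mem_iota => ? ->; lia.
exists (absz (c + k%:Z)); last by lia.
by rewrite mem_iota; lia.
Qed.

Lemma mem_colours l (c : int) :
  (c \in colours l) = (- l%:Z <= c *+ 2 <= l%:Z) && (odd l || (c != 0)).
Proof.
have E := odd_double_half l.
rewrite /colours mulr2n; case: (odd l) E => E; last rewrite mem_filter.
  by rewrite mem_int_range; lia.
by rewrite mem_int_range; lia.
Qed.

Lemma int_range_uniq k : uniq (int_range k).
Proof. by rewrite map_inj_uniq ?iota_uniq // => i j; lia. Qed.

Lemma colours_uniq l : uniq (colours l).
Proof. by rewrite /colours; case: odd; rewrite ?filter_uniq ?int_range_uniq. Qed.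

Lemma size_colours l : size (colours l) = l.
Proof.
have E := odd_double_half l.
rewrite /colours; case: (odd l) E => E; first by rewrite size_map size_iota.
rewrite size_filter -[RHS]E add0n.
have := count_predC (pred1 0) (int_range l./2).
rewrite count_uniq_mem ?int_range_uniq // mem_int_range size_map size_iota.
have -> : (- l./2%:Z <= 0 <= l./2%:Z) by lia.
by rewrite /= => -[].
Qed.

(* Counting by the pattern of equalities up to sign: the summand only needs to
   be invariant under odd injections of the colours, and the coordinates are
   summed out one at a time. *)
Definition odd_inj (phi : int -> int) :=
  injective phi /\ forall a, phi (- a) = - phi a.

Definition pattern_inv (F : seq int -> {poly int}) :=
  forall phi, odd_inj phi -> forall x, F (map phi x) = F x.

Lemma odd_inj0 phi : odd_inj phi -> phi 0 = 0.
Proof. by case=> _ /(_ 0); rewrite oppr0; move: (phi 0) => y; lia. Qed.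

Definition swap (a b z : int) : int :=
  if z == a then b else if z == b then a else
  if z == - a then - b else if z == - b then - a else z.

Lemma swap_odd_inj a b : a != 0 -> b != 0 -> odd_inj (swap a b).
Proof.
move=> a0 b0; split=> [|z].
  apply: (can_inj (g := swap a b)) => z; rewrite {2}/swap.
  case: (eqVneq z a) => [->|?]; last case: (eqVneq z b) => [->|?];
    last case: (eqVneq z (- a)) => [->|?]; last case: (eqVneq z (- b)) => [->|?];
    by rewrite /swap; repeat case: eqP => ?; lia.
by rewrite /swap; repeat case: eqP => ?; lia.
Qed.

Definition used (b : bool) (x : seq int) : seq int :=
  undup ((if b then [:: 0] else [::]) ++ x ++ map -%R x).

Definition fresh (x : seq int) : int := (\sum_(a <- x) absz a).+1%:Z.

Definition is_fresh (c : int) (x : seq int) :=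
  c != 0 /\ forall z, z \in x -> z != c /\ z != - c.

Lemma freshP x : is_fresh (fresh x) x.
Proof.
split=> // z zx.
have : (absz z <= \sum_(a <- x) absz a)%N by rewrite (big_rem z zx) leq_addr.
by rewrite /fresh; lia.
Qed.

Lemma fresh_eq F c d x : pattern_inv F -> is_fresh c x -> is_fresh d x ->
  F (c :: x) = F (d :: x).
Proof.
move=> Finv [c0 cx] [d0 dx].
rewrite -(Finv _ (swap_odd_inj c0 d0) (c :: x)) /= {1}/swap eqxx.
congr (F (d :: _)); rewrite -[RHS]map_id; apply/eq_in_map => z zx.
have [/negPf z1 /negPf z2] := cx _ zx; have [/negPf z3 /negPf z4] := dx _ zx.
by rewrite /swap z1 z2 z3 z4.
Qed.

Definition elim1 (b : bool) (F : seq int -> {poly int}) (x : seq int) :=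
  \sum_(d <- used b x) F (d :: x)
  + ('X - (size (used b x))%:R) * F (fresh x :: x).

Lemma used_map b phi x : odd_inj phi -> used b (map phi x) = map phi (used b x).
Proof.
move=> phiP; rewrite /used -(undup_map_inj phiP.1); congr undup.
rewrite !map_cat -!map_comp; congr (_ ++ (_ ++ _)).
  by case: b => //=; rewrite odd_inj0.
by apply: eq_map => z /=; rewrite phiP.2.
Qed.

Lemma elim1_inv b F : pattern_inv F -> pattern_inv (elim1 b F).
Proof.
move=> Finv phi phiP x; rewrite /elim1 used_map // size_map big_map.
congr (_ + _ * _); first by apply: eq_bigr => d _; rewrite -(Finv _ phiP (d :: x)).
rewrite -(Finv _ phiP (fresh x :: x)) /=; apply: fresh_eq => //; first exact: freshP.
have [f0 fx] := freshP x; split.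
  by rewrite -(odd_inj0 phiP) (inj_eq phiP.1).
move=> _ /mapP[z zx ->]; rewrite -phiP.2 !(inj_eq phiP.1); exact: fx.
Qed.

Lemma sum_colours F l x : pattern_inv F -> {subset x <= colours l} ->
  \sum_(c <- colours l) (F (c :: x)).[l%:Z] = (elim1 (odd l) F x).[l%:Z].
Proof.
move=> Finv xC; set U := used (odd l) x.
have UC : {subset U <= colours l}.
  move=> z; rewrite mem_undup !mem_cat => /or3P[|/xC //|/mapP[y /xC]].
    by rewrite mem_colours; case: (odd l) => //; rewrite inE => /eqP ->; lia.
  by rewrite !mem_colours !mulr2n => /andP[yl y0] ->; rewrite oppr_eq0 y0; lia.
have pU : perm_eq [seq c <- colours l | c \in U] U.
  apply: uniq_perm; rewrite ?filter_uniq ?colours_uniq ?undup_uniq //.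
  move=> z; rewrite mem_filter; case: (boolP (z \in U)) => // /UC ->; done.
rewrite (bigID (mem U)) /= -big_filter (perm_big _ pU) /=.
rewrite /elim1 hornerD horner_sum hornerM; congr (_ + _).
transitivity (\sum_(c <- colours l | c \notin U) (F (fresh x :: x)).[l%:Z]).
  rewrite big_seq_cond [RHS]big_seq_cond; apply: eq_bigr => c /andP[cC cU].
  congr (_.[_]); apply: fresh_eq => //; last exact: freshP.
  move: cU; rewrite mem_undup !mem_cat !negb_or => /and3P[c1 c2 c3]; split.
    move: cC c1; rewrite mem_colours; case: (odd l) => /=; last by case/andP.
    by rewrite inE.
  move=> z zx; split; first by apply: contraNneq c2 => <-.
  by apply: contraNneq c3 => zc; apply/mapP; exists z; rewrite // zc opprK.
rewrite big_const_seq iter_addr_0 hornerD hornerN hornerX.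
rewrite -polyC_natr hornerC -/U -[LHS]mulr_natl /=.
have := count_predC (mem U) (colours l).
rewrite -size_filter (perm_size pU) size_colours => cE.
congr (_ * _); rewrite !natz -[in RHS]cE PoszD addrC addKr.
by congr Posz; apply: eq_count.
Qed.

Lemma sum_seq_sub (C : seq int) (g : int -> int) : uniq C ->
  \sum_(c : seq_sub C) g (ssval c) = \sum_(c <- C) g c.
Proof.
move=> uC; rewrite -(big_map (@ssval _ C) xpredT g); apply: perm_big.
apply: uniq_perm => //.
  by rewrite map_inj_uniq ?index_enum_uniq //; exact: val_inj.
move=> z; apply/mapP/idP => [[[y yC] _ ->] //|zC].
by exists (SeqSub zC); rewrite ?mem_index_enum.
Qed.

Lemma sum_tuple_cons (T : finType) n (g : seq T -> int) :
  \sum_(t : n.+1.-tuple T) g t = \sum_(t : n.-tuple T) \sum_(c : T) g (c :: t).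
Proof.
rewrite pair_big /= (reindex (fun p : n.-tuple T * T => [tuple of p.2 :: p.1])) //=.
exists (fun t : n.+1.-tuple T => ([tuple of behead t], thead t)) => [[t c]|t] _ /=.
  by congr (_, _); apply/val_inj.
by rewrite [RHS]tuple_eta; apply/val_inj.
Qed.

Lemma tuple_sum_poly b n F : pattern_inv F ->
  {p : {poly int} | forall l, odd l = b ->
    \sum_(t : n.-tuple (seq_sub (colours l))) (F (map (@ssval _ _) t)).[l%:Z]
    = p.[l%:Z]}.
Proof.
elim: n F => [|n IHn] F Finv.
  exists (F [::]) => l _; rewrite (big_pred1 [tuple]) // => t.
  by apply/esym/eqP; rewrite [t]tuple0.
have [p pP] := IHn _ (elim1_inv b Finv); exists p => l lb.
rewrite -pP // (sum_tuple_cons _ (fun t => (F (map (@ssval _ _) t)).[l%:Z])).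
apply: eq_bigr => t _ /=.
rewrite (sum_seq_sub (fun c => (F (c :: map (@ssval _ _) t)).[l%:Z])) ?colours_uniq //.
by rewrite sum_colours ?lb // => _ /mapP[[z zC] _ ->].
Qed.

Definition proper_seq (S : signed_graph) (x : seq int) : bool :=
  [forall v : S, forall w : S, adj v w ==>
    (nth 0 x (enum_rank v) != sgn [set v; w] * nth 0 x (enum_rank w))].

Lemma proper_seq_inv S : pattern_inv (fun x => (proper_seq S x)%:R).
Proof.
move=> phi phiP x; congr (nat_of_bool _)%:R.
have nthE i : nth 0 (map phi x) i = phi (nth 0 x i).
  have [ix|ix] := ltnP i (size x); first by rewrite (nth_map 0).
  by rewrite !nth_default ?size_map // odd_inj0.
apply: eq_forallb => v; apply: eq_forallb => w; rewrite !nthE.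
case: (boolP (adj v w)) => //= /sgn_pm1 [] ->.
  by rewrite !mul1r (inj_eq phiP.1).
by rewrite !mulN1r -phiP.2 (inj_eq phiP.1).
Qed.

Lemma num_colouringsE S l : (num_colourings S l)%:Z =
  \sum_(t : #|S|.-tuple (seq_sub (colours l)))
    ((proper_seq S (map (@ssval _ _) t))%:R : {poly int}).[l%:Z].
Proof.
rewrite /num_colourings -sum1dep_card big_mkcond /= -natz natr_sum.
rewrite (reindex (fun t : #|S|.-tuple (seq_sub (colours l)) => Finfun t)) /=; last first.
  exists (@fgraph _ _) => ? _; [exact: FinfunK | exact: fgraphK].
apply: eq_bigr => t _.
have -> : proper_colouring (Finfun t) = proper_seq S (map (@ssval _ _) t).
  apply: eq_forallb => v; apply: eq_forallb => w.
  have E u : nth 0 (map (@ssval _ _) t) (enum_rank u) = ssval (Finfun t u).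
    rewrite (nth_map (Finfun t u)) ?size_tuple //.
    by rewrite -[t in LHS]FinfunK -tnth_nth tnth_fgraph enum_rankK.
  by rewrite !E.
by case: proper_seq; rewrite ?hornerC.
Qed.

Lemma quasi_poly_exists S b : {p : {poly int} |
  forall l, odd l = b -> (num_colourings S l)%:Z = p.[l%:Z]}.
Proof.
have [p pP] := tuple_sum_poly b #|S| (@proper_seq_inv S).
by exists p => l lb; rewrite num_colouringsE pP.
Qed.

(* Characterised by [EpolyP], [Epoly_unique], [OpolyP] and [Opoly_unique]. *)
Definition Epoly (S : signed_graph) : {poly int} := sval (quasi_poly_exists S false).
Definition Opoly (S : signed_graph) : {poly int} := sval (quasi_poly_exists S true).

Lemma EpolyP S l : ~~ odd l -> (num_colourings S l)%:Z = (Epoly S).[l%:Z].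
Proof. by move=> /negPf; apply: (svalP (quasi_poly_exists S false)). Qed.

Lemma OpolyP S l : odd l -> (num_colourings S l)%:Z = (Opoly S).[l%:Z].
Proof. exact: (svalP (quasi_poly_exists S true)). Qed.

Lemma poly_parity_inj (b : bool) (p q : {poly int}) :
  (forall l, odd l = b -> p.[l%:Z] = q.[l%:Z]) -> p = q.
Proof.
move=> pq; apply/eqP; rewrite -subr_eq0; apply/negPn/negP => nz.
pose rs := [seq (i.*2 + b)%N%:Z | i <- iota 0 (size (p - q))].
have rsU : uniq rs by rewrite map_inj_uniq ?iota_uniq // => i j; lia.
have rsR : all (root (p - q)) rs.
  apply/allP => _ /mapP[i _ ->]; rewrite rootE hornerD hornerN subr_eq0.
  by rewrite pq // oddD odd_double oddb.
by have := max_poly_roots nz rsR rsU; rewrite size_map size_iota ltnn.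
Qed.

Lemma Epoly_unique S p :
  (forall l, ~~ odd l -> (num_colourings S l)%:Z = p.[l%:Z]) -> p = Epoly S.
Proof.
by move=> pP; apply: (@poly_parity_inj false) => l /negbT lo; rewrite -pP // EpolyP.
Qed.

Lemma Opoly_unique S p :
  (forall l, odd l -> (num_colourings S l)%:Z = p.[l%:Z]) -> p = Opoly S.
Proof.
by move=> pP; apply: (@poly_parity_inj true) => l lo; rewrite -pP // OpolyP.
Qed.

(* Main.v *)
(* Inclusion-exclusion over the set A of violated edges writes f(Sigma, l) as
   the sum of (-1)^|A| N(A, l), where N(A, l) counts the maps to C_l with
   k(v) = sigma(vw) k(w) for all vw in A.  If A is balanced, switching gives
   N(A, l) = l^r with r the number of connected components of A, whatever the
   parity of l; if A is unbalanced, such a map vanishes on a negative cycle, so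
   N(A, l) = 0 for even l.  Hence E is the sum over the balanced A, which is O as
   well when Sigma is balanced.  Otherwise let g be the length of a shortest
   negative cycle.  Such a cycle has no chord, so for odd l an unbalanced A has
   N(A, l) = l^(n-g) if it is a negative g-cycle and N(A, l) <= l^(n-g-1) if not;
   all the leading terms come with the same sign (-1)^g, hence do not cancel. *)

Require Import Defs.
From mathcomp Require Import all_boot all_order all_algebra.
From mathcomp Require Import zify.

Set Implicit Arguments.
Unset Strict Implicit.
Unset Printing Implicit Defensive.

Import Order.TTheory GRing.Theory Num.Theory.
Local Open Scope ring_scope.

(** * Two-element sets and alternating sums over subsets *)

Lemma set2_inj (T : finType) (x y u w : T) : [set x; y] = [set u; w] ->
  x = u /\ y = w \/ x = w /\ y = u.
Proof.
move=> E; have: x \in [set u; w] by rewrite -E set21.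
have: y \in [set u; w] by rewrite -E set22.
have: u \in [set x; y] by rewrite E set21.
have: w \in [set x; y] by rewrite E set22.
by move=> /set2P[]-> /set2P[]-> /set2P[]? /set2P[]?; auto.
Qed.

(** Toggling a fixed element [b] of [B] is a sign-reversing involution on the subsets of [B], so for
    nonempty [B] the sum equals its own negative. *)
Lemma sum_sign_subsets (T : finType) (B : {set T}) :
  \sum_(A : {set T} | A \subset B) (-1) ^+ #|A| = (B == set0)%:R :> int.
Proof.
have [->|[b bB]] := set_0Vmem B.
  by rewrite (big_pred1 set0) ?cards0 ?eqxx // => A; rewrite subset0.
have /negPf -> : B != set0 by apply/set0Pn; exists b.
pose t (A : {set T}) := if b \in A then A :\ b else b |: A.
have tK : involutive t.
  move=> A; rewrite /t; case: (boolP (b \in A)) => bA.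
    by rewrite setD11 setD1K.
  by rewrite setU11 setU1K.
have tE : \sum_(A : {set T} | A \subset B) (-1) ^+ #|A| =
    - \sum_(A : {set T} | A \subset B) (-1) ^+ #|A| :> int.
  rewrite [LHS](reindex_inj (inv_inj tK)) /= -sumrN; apply: eq_big => A.
    rewrite /t; case: ifP => bA; last by rewrite subUset sub1set bB.
    by rewrite subDset (setUidPr _) ?sub1set.
  move=> _; rewrite /t; case: ifP => bA.
    by rewrite (cardsD1 b A) bA exprS mulN1r opprK.
  by rewrite cardsU1 bA exprS mulN1r.
by move: tE; set s := \sum_(_ | _) _; lia.
Qed.

(** * Signs along walks, and negative cycles *)

Section Cycles.

Variable S : signed_graph.
Implicit Types (A B : {set {set S}}) (u v w x y : S) (p c : seq S).

Definition neg v w : bool := sgn [set v; w] == -1.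

Lemma negC v w : neg v w = neg w v.
Proof. by rewrite /neg setUC. Qed.

Definition sub_adj A : rel S := fun v w => [set v; w] \in A.

Lemma sub_adj_sym A : symmetric (sub_adj A).
Proof. by move=> v w; rewrite /sub_adj setUC. Qed.

Lemma sub_adj_neq A v w : A \subset edges S -> sub_adj A v w -> v != w.
Proof.
move=> /subsetP AE /AE /edges_card2; apply: contra_eqN => /eqP ->.
by rewrite setUid cards1.
Qed.

Lemma sgn_neg A v w : A \subset edges S -> sub_adj A v w ->
  sgn [set v; w] = (-1) ^+ neg v w.
Proof. by move=> /subsetP AE /AE /sgn_pm1; rewrite /neg => -[] ->. Qed.

Fixpoint path_neg x p : bool :=
  if p is y :: p' then neg x y (+) path_neg y p' else false.

Lemma path_neg_cat x p q :
  path_neg x (p ++ q) = path_neg x p (+) path_neg (last x p) q.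
Proof. by elim: p x => //= y p IHp x; rewrite IHp addbA. Qed.

Lemma odd_num_neg x p : uniq (x :: p) ->
  odd (num_neg (x :: p)) = path_neg x (rcons p x).
Proof.
(* For the induction, the vertex [x] to which the walk returns stays fixed while its starting vertex
   [z] moves along [p]. *)
suff H z : uniq (z :: p) ->
    odd (count (fun v => neg v (next_at v x z p)) (z :: p)) =
    path_neg z (rcons p x) by move/H.
elim: p z => [|y p IHp] z; first by move=> _; rewrite /= eqxx addn0 oddb addbF.
move=> /[dup] /andP[zNyp uyp] _; rewrite rcons_cons [path_neg _ _]/= -IHp //.
rewrite -[z :: y :: p]cat1s count_cat oddD /= eqxx addn0 oddb.
congr (_ (+) odd _); apply: (@eq_in_count _ _ _ (y :: p)) => v vyp.
suff /negPf -> : v != z by [].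
by apply: contraNneq zNyp => <-.
Qed.

Definition neg_cycle A c : bool :=
  [&& cycle (sub_adj A) c, uniq c, (2 < size c)%N & odd (num_neg c)].

Lemma neg_cycleE A x p : neg_cycle A (x :: p) =
  [&& path (sub_adj A) x (rcons p x), uniq (x :: p), (1 < size p)%N
    & path_neg x (rcons p x)].
Proof.
rewrite /neg_cycle [cycle _ _]/=.
by case: (boolP (uniq (x :: p))) => [/odd_num_neg ->|]; rewrite ?andbF.
Qed.

Lemma num_neg_rot n c : uniq c -> num_neg (rot n c) = num_neg c.
Proof.
move=> uc; rewrite /num_neg; under eq_count do rewrite next_rot //.
by apply/permP; rewrite perm_rot.
Qed.

Lemma neg_cycle_rot A n c : neg_cycle A (rot n c) = neg_cycle A c.
Proof.
rewrite /neg_cycle rot_cycle rot_uniq size_rot.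
by case: (boolP (uniq c)) => [/num_neg_rot ->|]; rewrite ?andbF.
Qed.

Lemma sub_neg_cycle A B c : A \subset B -> neg_cycle A c -> neg_cycle B c.
Proof.
move=> /subsetP AB /and4P[cA *]; apply/and4P; split=> //.
by apply: sub_cycle cA => v w /AB.
Qed.

Lemma balanced_neg_cycleP : balanced S <-> forall c, ~~ neg_cycle (edges S) c.
Proof.
split=> [bal c|nc c [/andP[cc uc] c2]].
  by apply/negP => /and4P[cc uc c2]; apply/negP/bal; split=> //; apply/andP.
by apply: contra (nc c) => oc; apply/and4P.
Qed.

(** * Potentials: switchings that make every edge of [A] positive *)

Definition is_potential A (s : {ffun S -> bool}) : bool :=
  [forall v, forall w, sub_adj A v w ==> (neg v w == s v (+) s w)].

Lemma is_potentialP A (s : {ffun S -> bool}) :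
  reflect (forall v w, sub_adj A v w -> neg v w = s v (+) s w) (is_potential A s).
Proof.
apply: (iffP forallP) => [sP v w vw|sP v]; last first.
  by apply/forallP => w; apply/implyP => /sP ->.
by have /forallP /(_ w) /implyP /(_ vw) /eqP := sP v.
Qed.

Definition has_potential A : bool := [exists s, is_potential A s].

(** The values of [s] at inner vertices cancel in pairs; in particular, a closed walk has an even
    number of negative edges. *)
Lemma path_neg_potential A s x p : is_potential A s ->
  path (sub_adj A) x p -> path_neg x p = s x (+) s (last x p).
Proof.
move=> /is_potentialP sP; elim: p x => [|y p IHp] x /=; first by rewrite addbb.
by case/andP=> /sP -> /IHp ->; rewrite addbA addbK.
Qed.

(* Induction on A: an edge that disagrees with a potential of the others either
   joins two components, one of which is then flipped, or closes a path to a
   negative cycle. *)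
Lemma potential_or_neg_cycle A : A \subset edges S ->
  has_potential A \/ exists c, neg_cycle A c.
Proof.
have [n] := ubnP #|A|; elim: n A => // n IHn A An AE.
have [->|[a aA]] := set_0Vmem A.
  left; apply/existsP; exists [ffun=> false].
  by apply/is_potentialP => v w; rewrite /sub_adj inE.
have BE : A :\ a \subset edges S by rewrite (subset_trans _ AE) ?subsetDl.
have /cards2P[u [w [uw aE]]] : #|a| == 2%N.
  by rewrite edges_card2 // (subsetP AE).
have [|/existsP[s sP]|[c cB]] := IHn _ _ BE.
- by rewrite (cardsD1 a A) aA in An; lia.
- have cs := sym_connect_sym (@sub_adj_sym (A :\ a)).
  have adjA x y : sub_adj A x y ->
      sub_adj (A :\ a) x y \/ [set x; y] = [set u; w].
    rewrite /sub_adj in_setD1 -aE => ->.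
    by case: eqP => ?; [right | left].
  have [uwE|uwN] := eqVneq (neg u w) (s u (+) s w).
    left; apply/existsP; exists s; apply/is_potentialP => x y /adjA[].
      exact: (is_potentialP _ _ sP).
    by case/set2_inj=> -[-> ->]; rewrite // negC uwE addbC.
  have [/connectP[p0 /shortenP[p up upU _]] wE|Nuw] :=
    boolP (connect (sub_adj (A :\ a)) u w).
    right; exists (u :: p); have upA : path (sub_adj A) u p.
      by apply: sub_path up => x y; rewrite /sub_adj in_setD1 => /andP[].
    rewrite neg_cycleE upU rcons_path upA -wE /= /sub_adj setUC -aE aA /=.
    apply/andP; split; last first.
      rewrite -cats1 path_neg_cat (path_neg_potential sP up) -wE /= addbF negC.
      by move: uwN; case: neg; case: (s u); case: (s w).
    (* The cycle has at least three vertices: [p] is nonempty as [u != w], and it is not a single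
       step, since the edge [uw] was removed from [A]. *)
    case: p up wE {upU upA} => [|y [|? ?]] //= => [_ wE|/andP[]].
      by rewrite wE eqxx in uw.
    by rewrite /sub_adj in_setD1 => /andP[] /[swap] _ /[swap] _ /[swap] <-;
      rewrite aE eqxx.
  left; apply/existsP.
  exists [ffun v => s v (+) connect (sub_adj (A :\ a)) u v].
  apply/is_potentialP => x y /adjA[xy|/set2_inj xy]; rewrite !ffunE.
    rewrite (is_potentialP _ _ sP) // (same_connect_r cs (connect1 xy)).
    by case: (s x); case: (s y); case: connect.
  have E : neg u w = s u (+) connect (sub_adj (A :\ a)) u u
      (+) (s w (+) connect (sub_adj (A :\ a)) u w).
    rewrite connect0 (negPf Nuw).
    by move: uwN; case: neg; case: (s u); case: (s w).
  by case: xy => -[-> ->]; rewrite // negC E addbC.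
by right; exists c; apply: sub_neg_cycle cB; rewrite subsetDl.
Qed.

(** * Edge sets of cycles, and chords of shortest negative cycles *)

Definition cycle_edges c : {set {set S}} := [set [set v; next c v] | v in c].

Lemma mem_cycle_edges c v : v \in c -> [set v; next c v] \in cycle_edges c.
Proof. exact: imset_f. Qed.

Lemma cycle_edges_rot n c : uniq c -> cycle_edges (rot n c) = cycle_edges c.
Proof.
move=> uc; apply/setP => a.
by apply/imsetP/imsetP => -[v vc ->]; exists v; rewrite ?mem_rot ?next_rot // in vc *.
Qed.

Lemma sub_cycle_edges A c : cycle (sub_adj A) c -> cycle_edges c \subset A.
Proof. by move=> cA; apply/subsetP => _ /imsetP[v vc ->]; apply: next_cycle cA vc. Qed.

Lemma cycle_cycle_edges c : uniq c -> cycle (sub_adj (cycle_edges c)) c.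
Proof. by move=> uc; apply: cycle_from_next => // v; apply: mem_cycle_edges. Qed.

(** Two distinct vertices [v] and [w] giving the same edge would be each other's successors, so the
    cycle would have length two. *)
Lemma card_cycle_edges c : uniq c -> (2 < size c)%N ->
  #|cycle_edges c| = size c.
Proof.
move=> uc c2; rewrite -[RHS](card_uniqP uc) card_in_imset // => v w vc wc E.
have [[//]|[vE /esym wE]] := set2_inj E.
have [i q cE] := rot_to vc; move: wE vE c2 uc.
rewrite -(size_rot i c) -(rot_uniq i c) => wE vE c2 uc; move: wE vE.
have uc' : uniq c by rewrite rot_uniq in uc.
rewrite -!(next_rot i uc') cE; case: q cE uc c2 => [|y [|z q]] -> //=.
rewrite !inE !negb_or eqxx => /andP[/and3P[vy vz vq] _] _ ->.
by rewrite eqxx eq_sym (negPf vy) => /eqP; rewrite (negPf vz).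
Qed.

(* A chord would split the cycle into two shorter ones, one of them negative. *)
Lemma shortest_neg_cycle_chordless c u w :
  neg_cycle (edges S) c ->
  (forall d, neg_cycle (edges S) d -> (size c <= size d)%N) ->
  u \in c -> w \in c -> sub_adj (edges S) u w -> [set u; w] \in cycle_edges c.
Proof.
move=> nc cmin uc wc uw; have /and4P[_ Uc _ _] := nc.
have [i q cE] := rot_to uc; rewrite -(cycle_edges_rot i Uc).
move: wc Uc cmin nc; rewrite -(mem_rot i) -(rot_uniq i) -(neg_cycle_rot _ i).
rewrite -(size_rot i) {i uc}cE => wc Uc cmin nc.
have wq : w \in q.
  by move: wc; rewrite inE eq_sym (negPf (sub_adj_neq (subxx _) uw)).
move: Uc nc cmin; case/splitPr: wq => p1 p2 Uc; rewrite neg_cycleE.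
rewrite rcons_cat rcons_cons -cat_rcons path_neg_cat cat_path last_rcons.
case/and4P=> /andP[pth1 pth2] _ _ odd12 cmin.
(* The cycle now reads [u], [p1], [w], [p2]. If [p1] or [p2] is empty, then [u] and [w] are
   consecutive and [uw] is an edge of the cycle. *)
case: (posnP (size p1)) => [/size0nil p10|p1_gt0].
  rewrite {}p10 {pth1 odd12 cmin} in Uc *; suff {1}-> : w = next (u :: w :: p2) u.
    by apply: mem_cycle_edges; rewrite mem_head.
  by rewrite /= eqxx.
case: (posnP (size p2)) => [/size0nil p20|p2_gt0].
  rewrite {}p20 {pth2 odd12 cmin} in Uc *.
  suff {1}-> : u = next (u :: p1 ++ [:: w]) w.
    by rewrite setUC; apply: mem_cycle_edges; rewrite inE mem_cat mem_head !orbT.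
  by rewrite -(next_rot (size (u :: p1)) Uc) -cat_cons rot_size_cat /= eqxx.
have U1 : uniq (u :: rcons p1 w).
  by move: Uc; rewrite -cat_rcons -cat_cons cat_uniq => /andP[].
have U2 : uniq (w :: rcons p2 u).
  move: Uc; rewrite -cat_cons -(rot_uniq (size (u :: p1))) rot_size_cat.
  by rewrite -cat_rcons cat_uniq => /andP[].
(* The sign of the chord occurs in both closed walks and cancels in their sum, which is the odd
   parity of the whole cycle. *)
have [odd1|odd2] : path_neg u (rcons (rcons p1 w) u)
    \/ path_neg w (rcons (rcons p2 u) w).
  apply/orP; rewrite -(cats1 (rcons p1 w)) -(cats1 (rcons p2 u)).
  rewrite !path_neg_cat /= !last_rcons.
  rewrite (negC w u).
  by move: odd12; case: path_neg; case: path_neg; case: neg.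
- have /cmin : neg_cycle (edges S) (u :: rcons p1 w).
    rewrite neg_cycleE U1 odd1 rcons_path pth1 last_rcons sub_adj_sym uw /=.
    by rewrite size_rcons ltnS p1_gt0.
  rewrite /= size_cat size_rcons /= addnS !ltnS -[X in (_ <= X)%N]addn0.
  by rewrite leq_add2l leqNgt p2_gt0.
have /cmin : neg_cycle (edges S) (w :: rcons p2 u).
  by rewrite neg_cycleE U2 odd2 rcons_path pth2 last_rcons uw /= size_rcons ltnS p2_gt0.
rewrite /= size_cat size_rcons /= addnS !ltnS -[X in (_ <= X)%N]add0n.
by rewrite leq_add2r leqNgt p1_gt0.
Qed.

End Cycles.

(** * Inclusion-exclusion, and the number of maps satisfying an edge set *)

Section Counting.

Variable S : signed_graph.
Implicit Types (A : {set {set S}}) (u v w x y : S) (p c : seq S) (l : nat).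

Definition satisfies l A (k : {ffun S -> seq_sub (colours l)}) : bool :=
  [forall v, forall w,
     sub_adj A v w ==> (ssval (k v) == sgn [set v; w] * ssval (k w))].

Lemma satisfiesP l A (k : {ffun S -> seq_sub (colours l)}) :
  reflect (forall v w, sub_adj A v w -> ssval (k v) = sgn [set v; w] * ssval (k w))
          (satisfies A k).
Proof.
apply: (iffP forallP) => [kP v w vw|kP v]; last first.
  by apply/forallP => w; apply/implyP => /kP /eqP.
by have /forallP /(_ w) /implyP /(_ vw) /eqP := kP v.
Qed.

Definition nsat A l : nat :=
  #|[set k : {ffun S -> seq_sub (colours l)} | satisfies A k]|.

(** Each map is weighted by the alternating sum over the subsets of its set [viol] of violated
    edges, which is 1 if the map is proper and 0 otherwise; then the two sums are exchanged. *)
Lemma num_colourings_incl_excl l : (num_colourings S l)%:Z =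
  \sum_(A : {set {set S}} | A \subset edges S) (-1) ^+ #|A| * (nsat A l)%:Z.
Proof.
pose viol (k : {ffun S -> seq_sub (colours l)}) :=
  [set a in edges S | satisfies [set a] k].
have proper_viol k : proper_colouring k = (viol k == set0).
  apply/forallP/eqP => [kP|k0 v].
    apply/setP => a; rewrite !inE; apply/andP => -[aE].
    have /cards2P[v [w [_ aVW]]] : #|a| == 2%N by rewrite edges_card2.
    move=> /satisfiesP /(_ v w); rewrite /sub_adj aVW set11 => /(_ isT) E.
    have /forallP /(_ w) := kP v.
    by rewrite /adj -aVW aE aVW E eqxx.
  apply/forallP => w; apply/implyP => vw; apply/eqP => E.
  have: [set v; w] \in viol k; last by rewrite k0 inE.
  rewrite inE; apply/andP; split=> //; apply/satisfiesP => x y /set1P xy; rewrite xy.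
  case: (set2_inj xy) => -[-> ->] //.
  by rewrite E; case: (sgn_pm1 vw) => ->; lia.
have sat_viol k A : A \subset edges S -> satisfies A k = (A \subset viol k).
  move=> /subsetP AE; apply/satisfiesP/subsetP => [kP a aA|kP v w vw].
    rewrite !inE AE //; apply/satisfiesP => v w /set1P E; apply: kP.
    by rewrite /sub_adj E.
  have := kP _ vw; rewrite inE => /andP[_ /satisfiesP]; apply.
  exact: set11.
rewrite /num_colourings -sum1dep_card -natz natr_sum big_mkcond /=.
transitivity (\sum_(k : {ffun S -> seq_sub (colours l)})
    \sum_(A : {set {set S}} | A \subset viol k) (-1) ^+ #|A| : int).
  by apply: eq_bigr => k _; rewrite sum_sign_subsets proper_viol; case: ifP.
transitivity (\sum_(k : {ffun S -> seq_sub (colours l)})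
    \sum_(A : {set {set S}} | A \subset edges S)
    (if satisfies A k then (-1) ^+ #|A| else 0 : int)).
  apply: eq_bigr => k _; rewrite -big_mkcondr /=; apply: eq_bigl => A.
  apply/idP/andP => [AV|[AE]]; last by rewrite sat_viol.
  have AE : A \subset edges S.
    by apply: subset_trans AV _; apply/subsetP => a; rewrite inE => /andP[].
  by rewrite sat_viol.
rewrite exchange_big; apply: eq_bigr => A _ /=.
rewrite -big_mkcond sumr_const /nsat -mulr_natr natz.
by congr (_ * _%:Z); apply: eq_card => k; rewrite inE.
Qed.

Lemma card_colours l : #|{: seq_sub (colours l)}| = l.
Proof. by rewrite card_seq_sub ?colours_uniq // size_colours. Qed.

Lemma oppr_colours l (z : int) : z \in colours l -> - z \in colours l.
Proof. by rewrite !mem_colours !mulr2n oppr_eq0 => /andP[? ->]; lia. Qed.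

Definition flip l (b : bool) (z : seq_sub (colours l)) : seq_sub (colours l) :=
  if b then SeqSub (oppr_colours (ssvalP z)) else z.

Lemma ssval_flip l b (z : seq_sub (colours l)) : ssval (flip b z) = (-1) ^+ b * ssval z.
Proof. by case: b; rewrite ?mul1r ?mulN1r. Qed.

Lemma flipK l b : involutive (@flip l b).
Proof. by move=> z; apply: val_inj; rewrite /= !ssval_flip signrMK. Qed.

(** Every component has exactly one root, so this is the number of components of the graph on all of
    [S] with edge set [A], isolated vertices included. *)
Definition nroots A : nat := #|{: {x : S | roots (sub_adj A) x}}|.

(** After switching by the potential [s], satisfying [A] means being constant on its components;
    hence the maps correspond to free choices [h] of a colour at each root. *)
Lemma nsat_potential A l : A \subset edges S -> has_potential A ->
  nsat A l = (l ^ nroots A)%N.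
Proof.
move=> AE /existsP[s /is_potentialP sP].
have cs := sym_connect_sym (@sub_adj_sym S A).
pose rt v : {x : S | roots (sub_adj A) x} :=
  exist (roots (sub_adj A)) _ (roots_root cs v).
pose g (h : {ffun {x : S | roots (sub_adj A) x} -> seq_sub (colours l)}) :=
  [ffun v => flip (s v) (h (rt v))] : {ffun S -> seq_sub (colours l)}.
have g_inj : injective g.
  move=> h1 h2 /ffunP E; apply/ffunP => -[r rP].
  have := E r; rewrite !ffunE => /(can_inj (@flipK l _)).
  suff -> : rt r = exist (roots (sub_adj A)) r rP by [].
  by apply: val_inj; apply/eqP.
rewrite -[l in RHS]card_colours -card_ffun -(card_imset _ g_inj) /nsat.
apply: eq_card => k; rewrite inE; apply/satisfiesP/imsetP => [kP|[h _ ->] v w vw].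
  exists [ffun r => flip (s (val r)) (k (val r))] => //; apply/ffunP => v.
  rewrite !ffunE /=.
  have kE x y : connect (sub_adj A) x y -> flip (s x) (k x) = flip (s y) (k y).
    case/connectP=> p + ->; elim: p x => //= z p IHp x /andP[xz /IHp <-].
    apply: val_inj; rewrite /= !ssval_flip (kP _ _ xz) (sgn_neg AE xz) (sP _ _ xz).
    by rewrite mulrA -signr_addb addbA addbb.
  by rewrite -(kE _ _ (connect_root _ v)) flipK.
rewrite !ffunE !ssval_flip (sgn_neg AE vw) (sP _ _ vw) mulrA -signr_addb.
have -> : rt w = rt v; last by rewrite -addbA addbb addbF.
by apply: val_inj => /=; apply/eqP; rewrite eq_sym root_connect // connect1.
Qed.

(** Going once around the cycle from [v] multiplies the colour by -1, so it equals its own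
    negative. *)
Lemma neg_cycle_sat0 A c l (k : {ffun S -> seq_sub (colours l)}) v :
  A \subset edges S -> neg_cycle A c -> satisfies A k -> v \in c -> ssval (k v) = 0.
Proof.
move=> AE + /satisfiesP kP vc; have [i q cE] := rot_to vc.
rewrite -(neg_cycle_rot _ i) cE neg_cycleE => /and4P[pth _ _ odd_neg].
have kE x p : path (sub_adj A) x p ->
    ssval (k x) = (-1) ^+ path_neg x p * ssval (k (last x p)).
  elim: p x => [|y p IHp] x /=; first by rewrite mul1r.
  by case/andP=> xy /IHp E; rewrite (kP _ _ xy) (sgn_neg AE xy) signr_addb -mulrA E.
by have := kE _ _ pth; rewrite odd_neg last_rcons mulN1r; lia.
Qed.

Lemma nsat_even A c l : A \subset edges S -> neg_cycle A c -> ~~ odd l ->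
  nsat A l = 0%N.
Proof.
move=> AE cA lE; apply: eq_card0 => k; rewrite inE; apply/negP => kA.
case: c cA => [|v c] cA; first by rewrite /neg_cycle /= in cA.
have k0 := neg_cycle_sat0 AE cA kA (mem_head v c).
by have := ssvalP (k v); rewrite mem_colours k0 (negPf lE) eqxx andbF.
Qed.

Lemma nsat_le A l (D : {set S}) :
  (forall k1 k2 : {ffun S -> seq_sub (colours l)},
     satisfies A k1 -> satisfies A k2 -> {in D, k1 =1 k2} -> k1 = k2) ->
  (nsat A l <= l ^ #|D|)%N.
Proof.
move=> Dinj; have <- : #|{: {x | x \in D}}| = #|D|.
  by rewrite card_sig; apply: eq_card => x; rewrite inE.
rewrite -[l in (l ^ _)%N]card_colours -card_ffun.
pose res (k : {ffun S -> seq_sub (colours l)}) := [ffun x : {x | x \in D} => k (val x)].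
rewrite /nsat -(card_in_imset (f := res)); first exact: max_card.
move=> k1 k2; rewrite !inE => k1A k2A /ffunP E; apply: Dinj => // v vD.
by have := E (exist (fun x => x \in D) v vD); rewrite !ffunE.
Qed.

(** The colour 0, available for odd [l], can be put on all of [c], which leaves the colours off [c]
    free. *)
Lemma nsat_cycle_edges_ge c l : odd l ->
  (l ^ #|[predC c]| <= nsat (cycle_edges c) l)%N.
Proof.
move=> lO; have <- : #|{: {x | x \in [predC c]}}| = #|[predC c]|.
  by rewrite card_sig; apply: eq_card => x; rewrite inE.
rewrite -[l in (l ^ _)%N]card_colours -card_ffun.
have zP : 0 \in colours l by rewrite mem_colours lO mul0rn andbT; lia.
pose ext (h : {ffun {x | x \in [predC c]} -> seq_sub (colours l)}) :=
  [ffun v => if insub v is Some x then h x else SeqSub zP]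
  : {ffun S -> seq_sub (colours l)}.
have ext_inj : injective ext.
  move=> h1 h2 /ffunP E; apply/ffunP => x.
  by have := E (val x); rewrite !ffunE valK.
rewrite -(card_imset _ ext_inj); apply/subset_leq_card/subsetP => _ /imsetP[h _ ->].
rewrite inE; apply/satisfiesP => v w vw.
have ext0 x : x \in c -> ssval (ext h x) = 0.
  by move=> xc; rewrite ffunE insubF // inE /= xc.
suff [vc wc] : v \in c /\ w \in c by rewrite !ext0 ?mulr0.
have /imsetP[x xc /set2_inj] := vw.
by case=> -[-> ->]; rewrite mem_next.
Qed.

End Counting.

(** * Contributions of balanced and unbalanced edge sets *)

Section Balance.

Variable S : signed_graph.
Implicit Types (A : {set {set S}}) (c : seq S) (l : nat).

Definition balanced_poly : {poly int} :=
  \sum_(A : {set {set S}} | (A \subset edges S) && has_potential A)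
    (-1) ^+ #|A| *: 'X^(nroots A).

Definition unbalanced_sum l : int :=
  \sum_(A : {set {set S}} | (A \subset edges S) && ~~ has_potential A)
    (-1) ^+ #|A| * (nsat A l)%:Z.

Lemma num_colourings_split l :
  (num_colourings S l)%:Z = balanced_poly.[l%:Z] + unbalanced_sum l.
Proof.
rewrite num_colourings_incl_excl (bigID (@has_potential S)) /=; congr (_ + _).
rewrite horner_sum; apply: eq_bigr => A /andP[AE potA].
by rewrite hornerZ hornerXn nsat_potential // -!natz natrX.
Qed.

Lemma no_potential_neg_cycle A : A \subset edges S -> ~~ has_potential A ->
  exists c, neg_cycle A c.
Proof. by move=> AE /negPf npA; have [|//] := potential_or_neg_cycle AE; rewrite npA. Qed.

Lemma neg_cycle_no_potential A c : neg_cycle A c -> ~~ has_potential A.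
Proof.
case: c => [|x p] //; rewrite neg_cycleE => /and4P[pth _ _ odd_neg].
apply/negP => /existsP[s sP]; move: odd_neg.
by rewrite (path_neg_potential sP pth) last_rcons addbb.
Qed.

Lemma unbalanced_sum_even l : ~~ odd l -> unbalanced_sum l = 0.
Proof.
move=> lE; apply: big1 => A /andP[AE npA].
have [c cA] := no_potential_neg_cycle AE npA.
by rewrite (nsat_even AE cA lE) mulr0.
Qed.

Lemma Epoly_balanced_poly : Epoly S = balanced_poly.
Proof.
apply/esym/Epoly_unique => l lE.
by rewrite num_colourings_split unbalanced_sum_even ?addr0.
Qed.

(** Vertex sequences of a given length form a finite type, so it is decidable which lengths occur
    and a least one can be taken. *)
Lemma shortest_neg_cycle c : neg_cycle (edges S) c ->
  exists2 d, neg_cycle (edges S) d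
    & forall e, neg_cycle (edges S) e -> (size d <= size e)%N.
Proof.
move=> cN; pose P n := [exists t : n.-tuple S, neg_cycle (edges S) t].
have exP : exists n, P n by exists (size c); apply/existsP; exists (in_tuple c).
case: (ex_minnP exP) => n /existsP[t tN] nmin; exists t => // e eN.
by rewrite size_tuple; apply: nmin; apply/existsP; exists (in_tuple e).
Qed.

(* The colourings satisfying A vanish on a negative cycle of A; either this
   cycle is not a shortest one, or A has an edge off it, which is not a chord
   and so determines the colour of a further vertex. *)
Lemma nsat_no_potential_le A c l :
  neg_cycle (edges S) c ->
  (forall d, neg_cycle (edges S) d -> (size c <= size d)%N) ->
  A \subset edges S -> ~~ has_potential A -> #|A| != size c -> (0 < l)%N ->
  (l * nsat A l <= l ^ (#|S| - size c))%N.
Proof.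
move=> cN cmin AE npA Ac l0.
have [d dA] := no_potential_neg_cycle AE npA.
have dN := sub_neg_cycle AE dA; have cd := cmin d dN.
(* A set [D] on which the colours determine the map gives [nsat A l <= l ^ #|D|]; the strict bound
   on [#|D|] absorbs the extra factor [l]. *)
suff [D [Dc Dinj]] : exists D : {set S}, (#|D| < #|S| - size c)%N /\
    forall k1 k2 : {ffun S -> seq_sub (colours l)},
     satisfies A k1 -> satisfies A k2 -> {in D, k1 =1 k2} -> k1 = k2.
  apply: leq_trans (leq_pexp2l l0 Dc).
  by rewrite expnS leq_mul2l nsat_le ?orbT.
have /and4P[cycd Ud d2 _] := dA.
have cardD : #|[set v in d]| = size d by rewrite cardsE (card_uniqP Ud).
have Deq (k1 k2 : {ffun S -> seq_sub (colours l)}) v :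
    satisfies A k1 -> satisfies A k2 -> v \in d -> k1 v = k2 v.
  move=> k1A k2A vd; apply: val_inj => /=.
  by rewrite (neg_cycle_sat0 AE dA k1A vd) (neg_cycle_sat0 AE dA k2A vd).
have [cd_lt|dc] := ltnP (size c) (size d).
  exists (~: [set v in d]); split.
    have := cardsC [set v in d]; rewrite cardD => <-.
    by rewrite -addnBAC // -[X in (X < _)%N]add0n ltn_add2r subn_gt0.
  move=> k1 k2 k1A k2A E; apply/ffunP => v.
  have [vd|vNd] := boolP (v \in d); first exact: Deq.
  by apply: E; rewrite !inE.
have {cd dc}cd : size d = size c by apply/eqP; rewrite eqn_leq cd dc.
have dmin e : neg_cycle (edges S) e -> (size d <= size e)%N by rewrite cd; apply: cmin.
(* Otherwise [A] would equal [cycle_edges d], which has [size c] elements. *)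
have [a aA aNd] : exists2 a, a \in A & a \notin cycle_edges d.
  apply/subsetPn; apply: contra Ac => AD.
  by rewrite -cd -(card_cycle_edges Ud d2) eqn_leq !subset_leq_card ?sub_cycle_edges.
have [u [w [uw ud]]] : exists u w, sub_adj A u w /\ u \notin d.
  have /cards2P[u [w [_ aE]]] : #|a| == 2%N by rewrite edges_card2 // (subsetP AE).
  have [ud|?] := boolP (u \in d); last by exists u, w; rewrite /sub_adj -aE.
  have [wd|?] := boolP (w \in d); last by exists w, u; rewrite /sub_adj setUC -aE.
  case/negP: aNd; rewrite aE; apply: shortest_neg_cycle_chordless dmin _ _ _ => //.
  by rewrite /sub_adj -aE (subsetP AE).
have cardU : #|u |: [set v in d]| = (size c).+1 by rewrite cardsU1 inE ud cardD cd.
(* Besides [d], the vertex [u] can be left out: its colour follows from that of [w] through the edge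
   [uw], wherever [w] lies. *)
exists (~: (u |: [set v in d])); split.
  by have := cardsC (u |: [set v in d]); rewrite cardU => <-; rewrite addSnnS addKn.
move=> k1 k2 k1A k2A E.
have Eu v : v != u -> k1 v = k2 v.
  have [vd _|vNd vu] := boolP (v \in d); first exact: Deq.
  by apply: E; rewrite !inE negb_or vu.
apply/ffunP => v; have [->|/Eu //] := eqVneq v u; apply: val_inj => /=.
rewrite (satisfiesP _ _ k1A _ _ uw) (satisfiesP _ _ k2A _ _ uw) Eu //.
by rewrite eq_sym (sub_adj_neq AE uw).
Qed.

(** One explicit [l] replaces asymptotics. The unbalanced sets with [size c] edges contribute at
    least [l ^ m] with a common sign; the others contribute at most [K * l ^ m / l] in absolute
    value, which is less once [l] exceeds [K]. *)
Lemma unbalanced_sum_neq0 c : neg_cycle (edges S) c ->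
  exists2 l, odd l & unbalanced_sum l != 0.
Proof.
case/shortest_neg_cycle=> {}c cN cmin; have /and4P[cyc Uc c2 oddc] := cN.
(* [K] bounds the number of summands, and [l] is an odd number larger than [K]. *)
pose K := #|{set {set S}}|; pose l := K.*2.+1; pose m := (#|S| - size c)%N.
have lO : odd l by rewrite /= odd_double.
exists l => //; apply/eqP => sum0.
pose large A := [&& A \subset edges S, ~~ has_potential A & #|A| == size c].
pose small A := [&& A \subset edges S, ~~ has_potential A & #|A| != size c].
have small_le : (l * \sum_(A | small A) nsat A l <= K * l ^ m)%N.
  rewrite big_distrr /= -sum_nat_const.
  rewrite [X in (_ <= X)%N](bigID small) /=; apply: leq_trans (leq_addr _ _).
  by apply: leq_sum => A /and3P[AE npA Ac]; apply: nsat_no_potential_le.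
have large_ge : (l ^ m <= \sum_(A | large A) nsat A l)%N.
  have cE : neg_cycle (cycle_edges c) c by apply/and4P; rewrite cycle_cycle_edges.
  rewrite (bigD1 (cycle_edges c)) /=; last first.
    by rewrite /large sub_cycle_edges // (neg_cycle_no_potential cE) card_cycle_edges ?eqxx.
  apply: leq_trans (leq_addr _ _); apply: leq_trans (nsat_cycle_edges_ge _ lO).
  by rewrite /m -(cardC (mem c)) (card_uniqP Uc) addKn.
have large_small :
    \sum_(A | large A) (nsat A l)%:Z <= \sum_(A | small A) (nsat A l)%:Z.
  (* Multiplication by the common sign of the large terms makes them all nonnegative. *)
  have : \sum_(A | large A) (nsat A l)%:Z +
      \sum_(A | small A) (-1) ^+ (size c + #|A|) * (nsat A l)%:Z = 0.
    transitivity ((-1) ^+ size c * unbalanced_sum l); last by rewrite sum0 mulr0.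
    rewrite /unbalanced_sum [in RHS](bigID (fun A : {set {set S}} => #|A| == size c)) /=.
    rewrite mulrDr !mulr_sumr; congr (_ + _); apply: eq_big => A.
    - by rewrite /large andbA.
    - by case/and3P=> _ _ /eqP ->; rewrite signrMK.
    - by rewrite /small andbA.
    - by rewrite mulrA exprD.
  move/eqP; rewrite addr_eq0 => /eqP ->; rewrite -sumrN; apply: ler_sum => A _.
  by rewrite -signr_odd; case: odd; rewrite ?mul1r ?mulN1r; lia.
have {}large_small : (l ^ m <= \sum_(A | small A) nsat A l)%N.
  have toZ P : (\sum_(A | P A) nsat A l)%N%:Z = \sum_(A | P A) (nsat A l)%:Z.
    by rewrite -natz natr_sum; apply: eq_bigr => A _; rewrite natz.
  by apply: leq_trans large_ge _; rewrite -lez_nat !toZ.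
have lm0 : (0 < l ^ m)%N by rewrite expn_gt0.
have : (l * l ^ m <= K * l ^ m)%N.
  by apply: leq_trans small_le; rewrite leq_mul2l large_small orbT.
by rewrite leq_pmul2r // /l -addnn; lia.
Qed.

End Balance.

Theorem theorem2p6 (S : signed_graph) : balanced S <-> Epoly S = Opoly S.
Proof.
split=> [/balanced_neg_cycleP bal|EO].
  rewrite Epoly_balanced_poly; apply: Opoly_unique => l _.
  rewrite num_colourings_split /unbalanced_sum big1 ?addr0 // => A /andP[AE npA].
  have [c /(sub_neg_cycle AE)] := no_potential_neg_cycle AE npA.
  by rewrite (negPf (bal c)).
apply/balanced_neg_cycleP => c; apply/negP => /unbalanced_sum_neq0[l lO].
(* Both polynomials equal [balanced_poly], so the unbalanced sum would have to vanish at this odd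
   [l]. *)
have := OpolyP S lO; rewrite num_colourings_split -EO Epoly_balanced_poly.
by move/eqP; rewrite -subr_eq0 addrAC subrr add0r => ->.
Qed.
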